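(* Let $(A,B,\nabla)$ be an FS-Lie algebroid: $B\subset A$ is a pair of regular Lie algebroids over the same regular foliated manifold $(M,F)$, $L$ is an arbitrary (not necessarily regular) Lie algebroid on $M$, and $\nabla:L\to A$ is a flat $L$-connection in $A$. Let $\pmb g=\ker\#_A$ and $\pmb h=\ker\#_B$. Then the homomorphism $\Delta_{(A,B,\nabla)}$ commutes with the differentials $\bar\delta$ and $d_L$, i.e. for every invariant cross-section $\Psi\in\left(\Gamma\left(\bigwedge(\pmb g/\pmb h)^*\right)\right)^{\Gamma(B)}$, $$d_L\left(\Delta_{(A,B,\nabla)}\Psi\right)=\Delta_{(A,B,\nabla)}\left(\bar\delta\Psi\right).$$
   Context: A Lie algebroid over $M$ is a vector bundle $L\to M$ with an $\mathbb R$-Lie bracket $[\![\cdot,\cdot]\!]$ on $\Gamma(L)$ and a vector bundle map (anchor) $\#_L:L\to TM$ with $[\![\xi,f\eta]\!]=f[\![\xi,\eta]\!]+(\#_L\xi)(f)\,\eta$. It is regular if $\#_L$ has constant rank; it is over the foliated manifold $(M,F)$ if $F=\operatorname{Im}\#_L$. Here $A$ and $B$ are both regular over $(M,F)$, $j:B\hookrightarrow A$ is the inclusion of a Lie subalgebroid. An $L$-connection in $A$ is a vector bundle homomorphism $\nabla:L\to A$ (over $\mathrm{id}_M$) commuting with the anchors; it is flat if $[\![\nabla\xi,\nabla\eta]\!]=\nabla[\![\xi,\eta]\!]$ for all $\xi,\eta\in\Gamma(L)$, i.e. it is a homomorphism of Lie algebroids. Choose an auxiliary connection $\lambda:F\to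 B$ (a splitting, $\#_B\circ\lambda=\mathrm{id}_F$), and let $\breve\lambda:A\to\pmb g$, $\breve\lambda(a)=a-j\lambda(\#_A a)$, be the connection form of $j\circ\lambda$. Define $\omega_{B,\nabla}:L\to\pmb g/\pmb h$ by $\omega_{B,\nabla}(w)=[-\breve\lambda(\nabla w)]$ (this is independent of $\lambda$). Let $\Omega(L)=\Gamma(\bigwedge L^* )$ with $d_L$ the standard Lie algebroid differential $$(d_L\phi)(\xi_1,\dots,\xi_n)=\sum_i(-1)^{i-1}(\#_L\xi_i)\left(\phi(\xi_1,\dots\hat\imath\dots,\xi_n)\right)+\sum_{i<j}(-1)^{i+j}\phi([\![\xi_i,\xi_j]\!],\xi_1,\dots\hat\imath\dots\hat\jmath\dots,\xi_n).$$ The algebra homomorphism $\Delta_{(A,B,\nabla)}:\Gamma(\bigwedge(\pmb g/\pmb h)^* )\to\Omega(L)$ is, for $\Psi$ of degree $k$ and $w_i\in L_{|x}$, $$(\Delta_{(A,B,\nabla)}\Psi)_x(w_1\wedge\dots\wedge w_k)=\langle\Psi_x,\omega_{B,\nabla}(w_1)\wedge\dots\wedge\omega_{B,\nabla}(w_k)\rangle .$$ The subalgebra $(\Gamma(\bigwedge(\pmb g/\pmb h)^* ))^{\Gamma(B)}$ of invariant cross-sections consists (in degree $k$) of those $\Psi$ with $$(\#_B\circ\xi)\langle\Psi,[\nu_1]\wedge\dots\wedge[\nu_k]\rangle=\sum_{j=1}^k(-1)^{j-1}\langle\Psi,[[\![\xi,\nu_j]\!]]\wedge[\nu_1]\wedge\dots\hat\jmath\dots\wedge[\nu_k]\rangle$$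 for all $\xi\in\Gamma(B)$, $\nu_i\in\Gamma(\pmb g)$. The differential $\bar\delta$ on this subalgebra is $$\langle\bar\delta\Psi,[\nu_1]\wedge\dots\wedge[\nu_k]\rangle=\sum_{i<j}(-1)^{i+j+1}\langle\Psi,[[\![\nu_i,\nu_j]\!]]\wedge[\nu_1]\wedge\dots\hat\imath\dots\hat\jmath\dots\wedge[\nu_k]\rangle .$$ *)

(* Defs.v *)
From HB Require Import structures.
From mathcomp Require Import all_boot all_order all_algebra ring_quotient.
From mathcomp Require Import all_classical all_reals all_analysis.
Import Order.TTheory GRing.Theory Num.Theory.
Import numFieldNormedType.Exports.

Set Implicit Arguments.
Unset Strict Implicit.
Unset Printing Implicit Defensive.

Local Open Scope classical_set_scope.
Local Open Scope ring_scope.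

(** * Kernels and quotients of modules *)

Section Kernel.
Variables (R : pzRingType) (V W : lmodType R) (f : {linear V -> W}).

Definition ker_pred : {pred V} := [pred v | f v == 0].

Lemma ker_submod_closed : submod_closed ker_pred.
Proof.
split=> [|a u v]; rewrite !inE ?linear0 // => /eqP fu /eqP fv.
by rewrite linearP fu fv scaler0 addr0.
Qed.
HB.instance Definition _ := GRing.isSubmodClosed.Build R V ker_pred
  ker_submod_closed.

Definition kernel := {v : V | v \in ker_pred}.
HB.instance Definition _ := SubChoice.on kernel.
HB.instance Definition _ := [SubChoice_isSubLmodule of kernel by <:].

End Kernel.

Section QuotientModule.
Variables (R : pzRingType) (V : lmodType R) (S : submodClosed V).

Definition quotmod_pred : {pred V} := S.

Lemma quotmod_zmod_closed : zmod_closed quotmod_pred.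
Proof.
split=> [|u v Su Sv]; first exact: (rpred0 S).
by rewrite -scaleN1r; apply: (rpredD Su); apply: rpredZ.
Qed.
HB.instance Definition _ := GRing.isZmodClosed.Build V quotmod_pred
  quotmod_zmod_closed.

Definition quotmod := Quotient.quot quotmod_pred.
HB.instance Definition _ := GRing.Zmodule.on quotmod.

Definition quotmod_pi (v : V) : quotmod := \pi_(Quotient.quot quotmod_pred)%qT v.

Definition quotmod_scale (a : R) (q : quotmod) : quotmod :=
  quotmod_pi (a *: repr (q : Quotient.quot quotmod_pred)).

Lemma quotmod_pi_eq (u v : V) : quotmod_pi u = quotmod_pi v <-> u - v \in S.
Proof.
have -> : (u - v \in S) = (u - v \in quotmod_pred) by [].
by rewrite Quotient.idealrBE; split=> /eqP.
Qed.

Lemma quotmod_piK (q : quotmod) : quotmod_pi (repr (q : Quotient.quot quotmod_pred)) = q.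
Proof. exact: reprK. Qed.

Lemma quotmod_piD (u v : V) : quotmod_pi (u + v) = quotmod_pi u + quotmod_pi v.
Proof. exact: (raddfD (\pi_(Quotient.quot quotmod_pred))%qT u v). Qed.

Lemma quotmod_piZ a (v : V) : quotmod_pi (a *: v) = quotmod_scale a (quotmod_pi v).
Proof.
apply/quotmod_pi_eq; rewrite -scalerBr rpredZ //.
by apply/quotmod_pi_eq; rewrite quotmod_piK.
Qed.

Lemma quotmod_scalerA a b q :
  quotmod_scale a (quotmod_scale b q) = quotmod_scale (a * b) q.
Proof. by rewrite -[q]quotmod_piK -!quotmod_piZ scalerA. Qed.
Lemma quotmod_scale1r : left_id 1 quotmod_scale.
Proof. by move=> q; rewrite -[q]quotmod_piK -!quotmod_piZ scale1r. Qed.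
Lemma quotmod_scalerDr : right_distributive quotmod_scale +%R.
Proof.
move=> a p q; rewrite -[p]quotmod_piK -[q]quotmod_piK.
by rewrite -quotmod_piD -!quotmod_piZ scalerDr quotmod_piD.
Qed.
Lemma quotmod_scalerDl q : {morph quotmod_scale^~ q : a b / a + b}.
Proof.
by move=> a b; rewrite -[q]quotmod_piK -!quotmod_piZ scalerDl quotmod_piD.
Qed.
HB.instance Definition _ := GRing.Zmodule_isLmodule.Build R quotmod
  quotmod_scalerA quotmod_scale1r quotmod_scalerDr quotmod_scalerDl.

End QuotientModule.

(** * Smooth manifolds *)

(** [f] is C^oo on the open set [U]: all its iterated partial derivatives
    exist and are continuous on [U]. *)
Definition smooth_on (R : realType) n (U : set 'rV[R]_n) (f : 'rV[R]_n -> R) :=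
  forall (s : seq 'I_n) u, U u ->
    let g : 'rV[R]_n -> R^o :=
      foldr (fun i (h : 'rV[R]_n -> R^o) => 'D_(delta_mx 0 i) h) f s in
    {for u, continuous g} /\ forall i, derivable g u (delta_mx 0 i).

(** [mpar a] inverts the chart [mcoord a] on its image [mcoord a @` mdom a];
    values outside [mdom a], respectively outside the image, are junk. *)
Record manifold (R : realType) := Manifold {
  mspace :> topologicalType;
  mdim : nat;
  mchart : Type;
  mdom : mchart -> set mspace;
  mcoord : mchart -> mspace -> 'rV[R]_mdim;
  mpar : mchart -> 'rV[R]_mdim -> mspace;
  m_hausdorff : hausdorff_space mspace;
  m_second_countable : @second_countable mspace;
  m_cover : forall x, exists a, mdom a x;
  m_dom_open : forall a, open (mdom a);
  m_img_open : forall a, open (mcoord a @` mdom a);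
  m_coordK : forall a x, mdom a x -> mpar a (mcoord a x) = x;
  m_coord_cont : forall a x, mdom a x -> {for x, continuous (mcoord a)};
  m_par_cont : forall a u, (mcoord a @` mdom a) u ->
    {for u, continuous (mpar a)};
  m_transition : forall a b i,
    smooth_on (mcoord a @` (mdom a `&` mdom b))
              (fun u => mcoord b (mpar a u) 0 i)
}.

Section Manifold.
Variables (R : realType) (M : manifold R).

Definition msmooth_on (U : set M) (f : M -> R) :=
  forall a : mchart M,
    smooth_on (mcoord a @` (mdom a `&` U)) (fun u => f (mpar a u)).

Definition msmooth (f : M -> R) := msmooth_on setT f.

(** Tangent vectors at [x] are the derivations at [x] of C^oo(M).  A derivation
    is extended by [0] to the non-smooth functions, so that it can be applied
    to any function and so that Leibniz equality is equality on C^oo(M). *)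
Definition is_derivation (x : M) (v : (M -> R) -> R^o) :=
  [/\ forall (c : R) f g, msmooth f -> msmooth g ->
        v (fun y => c * f y + g y) = c * v f + v g,
      forall f g, msmooth f -> msmooth g ->
        v (fun y => f y * g y) = f x * v g + g x * v f &
      forall f, ~ msmooth f -> v f = 0].

Definition derivation_pred (x : M) : {pred (M -> R) -> R^o} :=
  [pred v | `[< is_derivation x v >]].

Lemma derivation_submod_closed x : submod_closed (derivation_pred x).
Proof.
split=> [|a u v].
  by apply/asboolP; split=> // *; rewrite /= !mulr0 addr0.
move=> /asboolP[u1 u2 u3] /asboolP[v1 v2 v3]; apply/asboolP.
have E f : (a *: u + v) f = a * u f + v f by [].
split=> [c f g sf sg|f g sf sg|f nf]; rewrite !E.
- rewrite u1 // v1 // !mulrDr !mulrA [a * c]mulrC -!addrA; congr (_ + _).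
  by rewrite addrCA.
- rewrite u2 // v2 // !mulrDr !mulrA [a * f x]mulrC [a * g x]mulrC.
  by rewrite -!addrA; congr (_ + _); rewrite addrCA.
- by rewrite u3 // v3 // mulr0 addr0.
Qed.
HB.instance Definition _ x := GRing.isSubmodClosed.Build R _ (derivation_pred x)
  (derivation_submod_closed x).

Definition tangent (x : M) := {v : (M -> R) -> R^o | v \in derivation_pred x}.
HB.instance Definition _ x := SubChoice.on (tangent x).
HB.instance Definition _ x := [SubChoice_isSubLmodule of tangent x by <:].

Definition lie_deriv (x : M) (v : tangent x) (f : M -> R) : R := \val v f.

Definition field_smooth (X : forall x : M, tangent x) :=
  forall f, msmooth f -> msmooth (fun x => lie_deriv (X x) f).

Definition has_dim (V : lmodType R) (S : set V) (q : nat) :=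
  exists e : 'I_q -> V,
    (forall c : 'I_q -> R, \sum_i c i *: e i = 0 -> forall i, c i = 0) /\
    S = [set \sum_i c i *: e i | c in @setT ('I_q -> R)].

Record foliation := Foliation {
  folF :> forall x : M, set (tangent x);
  fol_rank : nat;
  fol_dim : forall x, has_dim (@folF x) fol_rank;
  fol_smooth : forall x v, @folF x v ->
    exists X : forall y, tangent y,
      [/\ field_smooth X, forall y, @folF y (X y) & X x = v];
  fol_involutive : forall X Y Z : forall x, tangent x,
    field_smooth X -> field_smooth Y ->
    (forall x, @folF x (X x)) -> (forall x, @folF x (Y x)) ->
    (forall x f, msmooth f ->
       lie_deriv (Z x) f = lie_deriv (X x) (fun y => lie_deriv (Y y) f)
                         - lie_deriv (Y x) (fun y => lie_deriv (X y) f)) ->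
    forall x, @folF x (Z x)
}.

Arguments folF : clear implicits.

(** * Vector bundles *)

(** The local trivialisations [vcoord a] are fibrewise isomorphisms over
    [vdom a], with inverse [vframe a]; outside [vdom a] they are junk. *)
Record vbundle := VBundle {
  fiber :> M -> lmodType R;
  vrank : nat;
  vtriv : Type;
  vdom : vtriv -> set M;
  vcoord : vtriv -> forall x, {linear fiber x -> 'rV[R]_vrank};
  vframe : vtriv -> forall x, 'rV[R]_vrank -> fiber x;
  v_cover : forall x, exists a, vdom a x;
  v_dom_open : forall a, open (vdom a);
  v_coordK : forall a x, vdom a x -> cancel (vcoord a x) (@vframe a x);
  v_frameK : forall a x, vdom a x -> cancel (@vframe a x) (vcoord a x);
  v_transition : forall a b (u : 'rV[R]_vrank) i,
    msmooth_on (vdom a `&` vdom b) (fun x => vcoord b x (vframe a x u) 0 i)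
}.

Definition section_smooth (E : vbundle) (s : forall x, E x) :=
  forall (a : vtriv E) i, msmooth_on (vdom a) (fun x => vcoord a x (s x) 0 i).

(** * Lie algebroids *)

(** [bracket] is the Lie bracket of the smooth sections; its values on
    non-smooth arguments are junk.  That the anchor preserves brackets is a
    consequence of these axioms. *)
Record lie_algebroid := LieAlgebroid {
  lbundle :> vbundle;
  bracket : (forall x, lbundle x) -> (forall x, lbundle x) ->
    forall x, lbundle x;
  anchor : forall x, {linear lbundle x -> tangent x};
  anchor_smooth : forall s, section_smooth s ->
    field_smooth (fun x => anchor x (s x));
  bracket_smooth : forall s t, section_smooth s -> section_smooth t ->
    section_smooth (bracket s t);
  bracket_linear : forall (c : R) s t u x,
    section_smooth s -> section_smooth t -> section_smooth u ->
    bracket (fun y => c *: s y + t y) u x = c *: bracket s u x + bracket t u x;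
  bracket_antisym : forall s t x, section_smooth s -> section_smooth t ->
    bracket s t x = - bracket t s x;
  bracket_jacobi : forall s t u x,
    section_smooth s -> section_smooth t -> section_smooth u ->
    bracket s (bracket t u) x + bracket t (bracket u s) x
      + bracket u (bracket s t) x = 0;
  bracket_leibniz : forall f s t x,
    msmooth f -> section_smooth s -> section_smooth t ->
    bracket s (fun y => f y *: t y) x
      = f x *: bracket s t x + lie_deriv (anchor x (s x)) f *: t x
}.

Definition anchor_image (A : lie_algebroid) (x : M) : set (tangent x) :=
  [set anchor A x a | a in @setT (A x)].

Definition regular_algebroid (A : lie_algebroid) :=
  exists q, forall x, has_dim (@anchor_image A x) q.

Definition over_foliation (A : lie_algebroid) (F : foliation) :=
  forall x, F x = @anchor_image A x.

Record connection (L A : lie_algebroid) := Connection {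
  conn :> forall x, {linear L x -> A x};
  conn_smooth : forall s, section_smooth s ->
    section_smooth (fun x => conn x (s x));
  conn_anchor : forall x w, anchor A x (conn x w) = anchor L x w
}.

Definition flat_connection (L A : lie_algebroid) (D : connection L A) :=
  forall s t x, section_smooth s -> section_smooth t ->
    bracket (fun y => D y (s y)) (fun y => D y (t y)) x
      = D x (bracket s t x).

(** The inclusion of a Lie subalgebroid over the same base: an injective
    homomorphism of Lie algebroids over the identity. *)
Record subalgebroid (B A : lie_algebroid) := Subalgebroid {
  incl :> connection B A;
  incl_flat : flat_connection incl;
  incl_inj : forall x, injective (incl x)
}.

Record splitting (F : foliation) (B : lie_algebroid) := Splitting {
  split_map :> forall x, tangent x -> B x;
  split_linear : forall x (c : R) v w, F x v -> F x w ->
    split_map (c *: v + w) = c *: split_map v + split_map w;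
  split_smooth : forall X, field_smooth X -> (forall x, F x (X x)) ->
    section_smooth (fun x => split_map (X x));
  split_anchor : forall x v, F x v -> anchor B x (split_map v) = v
}.

End Manifold.

(** * Forms *)

(** An element of the k-th exterior power of the dual of [V] is an alternating
    k-linear map, evaluated on [w_1 /\ ... /\ w_k] as [phi (fun i => w i)]. *)
Definition alternating_multilinear (R : realType) (V : lmodType R) k
    (phi : ('I_k -> V) -> R) :=
  (forall (i : 'I_k) (w : 'I_k -> V) (c : R) u v,
     phi (fun l => if l == i then c *: u + v else w l)
     = c * phi (fun l => if l == i then u else w l)
       + phi (fun l => if l == i then v else w l)) /\
  (forall (w : 'I_k -> V) (i j : 'I_k), i != j -> w i = w j -> phi w = 0).

(** The [k] arguments [b, s_0, s_1, ...]; in its uses below [s] has size [k - 1]. *)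
Definition front (V : Type) k (b : V) (s : seq V) : 'I_k -> V :=
  fun m => nth b (b :: s) m.

Section LieAlgebroidForms.
Variables (R : realType) (M : manifold R) (L : lie_algebroid M).

Definition Lform k := forall x : M, ('I_k -> L x) -> R.

(** Indices start at [0], so [(-1)^(i-1)] becomes [(-1) ^+ i]. *)
Definition dL_formula k (phi : Lform k) (xi : 'I_k.+1 -> forall x, L x) (x : M)
    : R :=
  \sum_(i < k.+1) (-1) ^+ i *
    lie_deriv (anchor L x (xi i x)) (fun y => phi y (fun m => xi (lift i m) y))
  + \sum_(i < k.+1) \sum_(j < k.+1 | (i < j)%N) (-1) ^+ (i + j) *
      phi x (front (bracket (xi i) (xi j) x)
                   [seq xi l x | l <- enum 'I_k.+1 & (l != i) && (l != j)]).

(** The value at [w_1 /\ ... /\ w_(k+1)] is that of the formula on any smooth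
    sections extending the [w_i]. *)
Definition dL k (phi : Lform k) : Lform k.+1 := fun x w =>
  xget 0 [set r : R | exists xi : 'I_k.+1 -> forall x, L x,
    [/\ forall i, section_smooth (xi i), forall i, xi i x = w i
      & r = dL_formula phi xi x]].

End LieAlgebroidForms.

Arguments dL {R M L k} phi x w.

(** * The pair (A, B) *)

Section Pair.
Variables (R : realType) (M : manifold R).
Variables (A B : lie_algebroid M) (j : subalgebroid B A).

Definition isotropy (x : M) : lmodType R := kernel (anchor A x).

Definition isotropy_section (nu : forall x, A x) :=
  section_smooth nu /\ forall x, anchor A x (nu x) = 0.

Definition isotropy_sub_pred (x : M) : {pred isotropy x} :=
  [pred u | `[< exists2 b : B x, anchor B x b = 0 & j x b = \val u >]].

Lemma isotropy_sub_closed x : submod_closed (@isotropy_sub_pred x).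
Proof.
split=> [|a u v]; first by apply/asboolP; exists 0; rewrite !linear0.
move=> /asboolP[b b0 jb] /asboolP[c c0 jc]; apply/asboolP.
by exists (a *: b + c); rewrite linearP ?b0 ?c0 ?scaler0 ?addr0 // jb jc linearP.
Qed.
HB.instance Definition _ x := GRing.isSubmodClosed.Build R _
  (@isotropy_sub_pred x) (isotropy_sub_closed x).

(** The fibre of g/h. *)
Definition isotropy_quot (x : M) : lmodType R :=
  quotmod (@isotropy_sub_pred x : submodClosed (isotropy x)).

(** The class [[a]] in [(g/h)_x] of [a \in g_x]; junk if [a \notin g_x]. *)
Definition cls (x : M) (a : A x) : isotropy_quot x :=
  quotmod_pi _ (insubd (0 : isotropy x) a).

Definition Qform k := forall x : M, ('I_k -> isotropy_quot x) -> R.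

(** [Psi] is a smooth cross-section of the k-th exterior power of (g/h)^*. *)
Definition is_Qform k (Psi : Qform k) :=
  (forall x, alternating_multilinear (Psi x)) /\
  (forall nu : 'I_k -> forall x, A x, (forall i, isotropy_section (nu i)) ->
     msmooth (fun x => Psi x (fun i => cls (nu i x)))).

Definition B_invariant k (Psi : Qform k) :=
  forall (xi : forall x, B x) (nu : 'I_k -> forall x, A x) (x : M),
    section_smooth xi -> (forall i, isotropy_section (nu i)) ->
    lie_deriv (anchor B x (xi x)) (fun y => Psi y (fun i => cls (nu i y)))
    = \sum_(l < k) (-1) ^+ l *
        Psi x (front (cls (bracket (fun y => j y (xi y)) (nu l) x))
                     [seq cls (nu m x) | m <- enum 'I_k & m != l]).

Definition bar_delta_formula k (Psi : Qform k) (nu : 'I_k.+1 -> forall x, A x)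
    (x : M) : R :=
  \sum_(p < k.+1) \sum_(q < k.+1 | (p < q)%N) (-1) ^+ (p + q).+1 *
    Psi x (front (cls (bracket (nu p) (nu q) x))
             [seq cls (nu l x) | l <- enum 'I_k.+1 & (l != p) && (l != q)]).

(** As for [dL], evaluated on any sections of g representing the arguments. *)
Definition bar_delta k (Psi : Qform k) : Qform k.+1 := fun x w =>
  xget 0 [set r : R | exists nu : 'I_k.+1 -> forall x, A x,
    [/\ forall i, isotropy_section (nu i), forall i, cls (nu i x) = w i
      & r = bar_delta_formula Psi nu x]].

Section Characteristic.
Variables (F : foliation M) (lambda : splitting F B).
Variables (L : lie_algebroid M) (nabla : connection L A).

Definition connection_form (x : M) (a : A x) : A x :=
  a - j x (lambda x (anchor A x a)).

Definition omega (x : M) (w : L x) : isotropy_quot x :=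
  cls (- connection_form (nabla x w)).

Definition Delta_hom k (Psi : Qform k) : Lform L k :=
  fun x w => Psi x (fun i => omega (w i)).

End Characteristic.
End Pair.

Arguments bar_delta {R M A B j k} Psi x w.
Arguments Delta_hom {R M A B j F} lambda {L} nabla {k} Psi x w.

(* Main.v *)
Require Import Defs.
From mathcomp Require Import all_boot all_order all_algebra.
From mathcomp Require Import all_classical all_reals all_analysis.
From mathcomp Require Import ring.
Import Order.TTheory GRing.Theory Num.Theory.
Import numFieldNormedType.Exports.

(** Write [#] for the anchors.  For a section [xi] of [L] put
    [beta = lambda(# nabla xi)], a section of [B], and [nu = j beta - nabla xi],
    a section of the isotropy [g] whose class modulo [h] is [omega xi].  In the
    differential of [Delta Psi] at [xi_0, ..., xi_k], the derivatives along
    [# xi_i = # beta_i] are, by invariance of [Psi], sums of values of [Psi] at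
    brackets [[j beta_i, nu_m]] ([invariant_sum]).  By flatness,
    [nabla [xi_p, xi_q]] is the bracket of [j beta_p - nu_p] and
    [j beta_q - nu_q], so that omega sends [[xi_p, xi_q]] to the class of
    [[j beta_p, nu_q] - [j beta_q, nu_p] - [nu_p, nu_q]].  The terms in [beta]
    cancel and only the brackets [[nu_p, nu_q]] remain, which form the algebraic
    differential of [Psi] at the [nu_i] ([dL_Delta_formula]).

    Both differentials are given at a point through an unspecified choice of
    sections, so two facts about sections are needed as well.

    Every vector extends to a smooth section ([section_extension]); otherwise the
    differential of [Delta Psi] would have no meaning at that vector.  This rests
    on bump functions, built here from exp(-1/t).  Their smoothness comes
    from a coinduction principle: the expressions built from smooth functions by
    sums, products and composition with t^(-k) exp(-1/t), extended by zero, are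
    stable under partial derivatives ([smooth_on_coind], [smooth_expr_smooth], [bump_function]).

    The algebraic differential depends only on the classes of the sections at the
    point ([bar_delta_formula_cls]).  Brackets of isotropy sections are
    fibrewise ([bracket_isotropy_congr]), which requires that the bracket with an
    isotropy section be isotropic ([anchor_bracket_isotropy], from the Jacobi
    identity) and linear over functions ([bracket_vanish]).  A change of
    representatives by values in [h] extends to sections of [h], using the
    splitting, and then contributes nothing by invariance. *)

Set Implicit Arguments.
Unset Strict Implicit.
Unset Printing Implicit Defensive.

Local Open Scope classical_set_scope.
Local Open Scope ring_scope.

(** * A flat function *)

Section Flat.
Variable R : realType.
Implicit Types (k : nat) (t : R).

(** With [k = 0] this is the classical flat function, equal to exp(-1/t) for
    [t > 0]; the powers of [1/t] are carried along so that the derivatives of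
    the family, in [k], are combinations of its members. *)
Definition flat k t : R := if 0 < t then (t^-1) ^+ k * expR (- t^-1) else 0.

Lemma flat_gt0 k t : 0 < t -> 0 < flat k t.
Proof. by move=> t0; rewrite /flat t0 mulr_gt0 ?expR_gt0 ?exprn_gt0 ?invr_gt0. Qed.

Lemma flat_eq0 k t : t <= 0 -> flat k t = 0.
Proof. by rewrite /flat ltNge => ->. Qed.

(** The exponential beats every power: exp(s) dominates s^(k+2)/(k+2)! at
    [s = 1/t].  The square on the right forces the derivative at [0] to vanish. *)
Lemma normr_flat_le k t : `|flat k t| <= (k.+2)`!%:R * t ^+ 2.
Proof.
have [t0|t0] := ltP 0 t; last first.
  by rewrite flat_eq0 // normr0 mulr_ge0 // sqr_ge0.
rewrite ger0_norm ?(ltW (flat_gt0 k t0)) // /flat t0 /= expRN.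
have s0 : 0 < t^-1 by rewrite invr_gt0.
have -> : t ^+ 2 = (t^-1 ^+ 2)^-1 by rewrite exprVn invrK.
rewrite ler_pdivrMr ?expR_gt0 // -mulrA mulrCA.
rewrite ler_pdivlMl ?exprn_gt0 // -exprD add2n -ler_pdivrMl ?ltr0n ?fact_gt0 //.
rewrite mulrC; apply: le_trans (expR_ge1Dxn k.+1 (ltW s0)).
by rewrite lerDr.
Qed.

Lemma is_derive_flat k t :
  is_derive t 1 (flat k) (flat k.+2 t - k%:R * flat k.+1 t).
Proof.
have [t0|t0|->] := ltgtP t 0.
- rewrite !flat_eq0 ?(ltW t0) // mulr0 subr0.
  apply: near_eq_is_derive (is_derive_cst _ _ _).
  near=> s; rewrite flat_eq0 //; apply/ltW; near: s.
  exact: lt_nbhsl.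
- have t_neq0 : t != 0 by rewrite gt_eqF.
  have V : is_derive t 1 (fun s : R => s^-1) (- t ^- 2).
    split; first by apply: derivableV.
    by rewrite (deriveV (f := id)) ?derive_id // /GRing.scale /= mulr1.
  have E : is_derive t 1 (fun s : R => expR (- s^-1)) (expR (- t^-1) * t ^- 2).
    apply: (@is_derive1_comp _ expR (fun s => - s^-1)).
    by rewrite -[X in is_derive _ _ _ X]opprK; apply: is_deriveN.
  have nE : \forall s \near t, (s^-1) ^+ k * expR (- s^-1) = flat k s :> R^o.
    by near=> s; rewrite /flat ifT //; near: s; exact: lt_nbhsr.
  refine (near_eq_is_derive nE _).
  have -> : (fun s : R => s^-1 ^+ k * expR (- s^-1)) =
      ((fun s : R => s^-1) ^+ k * (fun s : R => expR (- s^-1)))%R.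
    by apply/funext=> s; rewrite /GRing.mul/= exprfctE.
  apply: is_derive_eq (is_deriveM (is_deriveX k V) E) _.
  rewrite exprfctE /flat t0 /GRing.scale /=.
  case: k {nE} => [|k] /=; first by rewrite !expr0 !mulr0n; field.
  by rewrite !exprS -mulr_natl; field.
- rewrite !flat_eq0 // mulr0 subr0.
  suff H : h^-1 *: (flat k (h *: 1 + 0) - flat k 0) @[h --> 0^'] --> (0 : R).
    by split; [apply/cvg_ex; exists 0|exact: cvg_lim H].
  apply/cvgr0Pnorm_le => e e0.
  have C0 : 0 < ((k.+2)`!%:R : R) by rewrite ltr0n fact_gt0.
  near=> h.
  have h0 : h != 0 by near: h; exact: nbhs_dnbhs_neq.
  rewrite addr0 (flat_eq0 k (lexx 0)) subr0 normrZ normfV /GRing.scale /= mulr1.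
  rewrite ler_pdivrMl ?normr_gt0 //; apply: le_trans (normr_flat_le _ _) _.
  rewrite -real_normK ?num_real // expr2 mulrCA ler_wpM2l // mulrC -ler_pdivlMr //.
  by apply/ltW; near: h; apply: dnbhs0_lt; apply: divr_gt0.
Unshelve. all: by end_near. Qed.

End Flat.

(** * Calculus of smooth functions on open sets *)

Section SmoothCalculus.
Variables (R : realType) (n : nat) (W : set 'rV[R]_n).
Implicit Types (f g : 'rV[R]_n -> R^o) (u : 'rV[R]_n) (i : 'I_n).

Local Notation pd i f := ('D_(delta_mx 0 i) f).

Lemma near_eq_continuous f g u : (\forall y \near u, f y = g y) ->
  {for u, continuous f} -> {for u, continuous g}.
Proof.
move=> fg fc; rewrite /prop_for /continuous_at -(nbhs_singleton fg).
apply: cvg_trans fc => A; apply: (near_eq_cvg fg).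
Qed.

Lemma is_derive_line f u v df :
  is_derive u v f df <-> is_derive (0 : R) 1 (fun h : R => f (h *: v + u)) df.
Proof.
have E : (fun h : R => h^-1 *: (f (h *: v + u) - f u)) =
   (fun h : R => h^-1 *: (f ((h *: 1 + 0) *: v + u) - f (0 *: v + u))).
  by apply/funext => h; rewrite scale0r add0r addr0 /GRing.scale /= mulr1.
have D : derivable f u v <-> derivable (fun h : R => f (h *: v + u) : R^o) 0 1.
  exact: derivable1P.
have D' : 'D_v f u = 'D_1 (fun h : R => f (h *: v + u) : R^o) 0.
  by rewrite /derive /= E.
split=> -[d1 d2]; split; first exact/D.
- by rewrite -D'.
- exact/D.
- by rewrite D'.
Qed.

Lemma is_derive_flat_comp k f u v df : is_derive u v f df ->
  is_derive u v (fun y => flat k (f y) : R^o)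
    ((flat k.+2 (f u) - k%:R * flat k.+1 (f u)) * df).
Proof.
move=> /is_derive_line fu; apply/is_derive_line.
apply: (@is_derive1_comp _ (flat k) (fun h : R => f (h *: v + u))) => //.
by rewrite scale0r add0r; apply: is_derive_flat.
Qed.

Lemma smooth_on_pd f i : smooth_on W f -> smooth_on W (pd i f).
Proof. by move=> sf s u Wu; have := sf (rcons s i) u Wu; rewrite foldr_rcons. Qed.

Hypothesis W_open : open W.

(** Derivatives are local, and the set is open. *)
Lemma foldr_pd_eq f g (s : seq 'I_n) : {in W, f =1 g} ->
  {in W, foldr (fun i h => pd i h) f s =1 foldr (fun i h => pd i h) g s}.
Proof.
move=> fg; elim: s => //= i s IH u uW; apply: near_eq_derive.
have /open_nbhs_nbhs : open_nbhs u W by split => //; exact: set_mem.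
by apply: filterS => y Wy; apply: IH; rewrite inE.
Qed.

(** Coinduction principle for smoothness: a class of differentiable functions
    that is stable, up to equality on the open set, under partial derivatives
    consists of smooth functions.  It spares formulas for iterated derivatives
    of products and composites. *)
Lemma smooth_on_coind (P : ('rV[R]_n -> R^o) -> Prop) :
  (forall f u, P f -> W u ->
    {for u, continuous f} /\ forall i, derivable f u (delta_mx 0 i)) ->
  (forall f i, P f -> exists2 g, P g & {in W, pd i f =1 g}) ->
  forall f, P f -> smooth_on W f.
Proof.
move=> P0 P1 f Pf s u Wu; have nW : nbhs u W by exact: open_nbhs_nbhs.
suff [g Pg fg] : exists2 g, P g & {in W, foldr (fun i h => pd i h) f s =1 g}.
  have nE : \forall y \near u, g y = foldr (fun i h => pd i h) f s y.
    by apply: filterS nW => y Wy; rewrite fg ?inE.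
  have [gc gd] := P0 g u Pg Wu; split=> [|i].
    exact: near_eq_continuous nE gc.
  exact: near_eq_derivable nE (gd i).
elim/last_ind: s f Pf => [|s i IH] f Pf; first by exists f.
have [g Pg /foldr_pd_eq fg] := P1 f i Pf; have [h Ph gh] := IH g Pg.
by exists h => // y yW; rewrite foldr_rcons fg ?gh.
Qed.

Lemma smooth_on_eq f g : {in W, f =1 g} -> smooth_on W f -> smooth_on W g.
Proof.
move=> fg sf; apply: (@smooth_on_coind (fun h =>
  exists2 f, smooth_on W f & {in W, h =1 f})); last first.
- by exists f => // u uW; rewrite fg.
- move=> {}g i [{fg sf}f sf gf]; exists (pd i f); last first.
    by move=> u uW; apply: (@foldr_pd_eq g f [:: i]).
  by exists (pd i f) => //; exact: smooth_on_pd.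
move=> {}g u [{fg sf}f sf gf] Wu; have [fc fd] := sf [::] u Wu.
have nE : \forall y \near u, f y = g y.
  apply: filterS (open_nbhs_nbhs (conj W_open Wu)) => y Wy.
  by rewrite gf ?inE.
split=> [|i]; first exact: near_eq_continuous nE fc.
exact: near_eq_derivable nE (fd i).
Qed.

Lemma smooth_on_cst (c : R) : smooth_on W (fun=> c).
Proof.
apply: (@smooth_on_coind (fun f => exists c, f = cst c)); last by exists c.
- move=> _ u [d ->] _; split=> [|i]; first exact: cst_continuous.
  exact: derivable_cst.
- move=> _ i [d ->]; exists (cst 0); first by exists 0.
  by move=> u _; exact: derive_cst.
Qed.

(** The smallest class containing the smooth functions and closed under sums,
    products and composition with the flat functions.  By the Leibniz and chain
    rules it is stable under partial derivatives, so it contains nothing but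
    smooth functions; the three closure properties follow together. *)
Inductive smooth_expr : ('rV[R]_n -> R^o) -> Prop :=
| SmoothAtom f : smooth_on W f -> smooth_expr f
| SmoothAdd f g : smooth_expr f -> smooth_expr g -> smooth_expr (f + g)
| SmoothMul f g : smooth_expr f -> smooth_expr g -> smooth_expr (f * g)
| SmoothFlat k f : smooth_expr f -> smooth_expr (fun u => flat k (f u)).

Lemma smooth_expr_continuous f u : smooth_expr f -> W u -> {for u, continuous f}.
Proof.
move=> sf Wu.
elim: sf => {f} [f /(_ [::] u Wu)[]//|f g _ cf _ cg|f g _ cf _ cg|k f _ cf].
- exact: (continuousD cf cg).
- exact: (continuousM cf cg).
- apply: continuous_comp => //.
  apply/differentiable_continuous/derivable1_diffP.
  by have [] := is_derive_flat k (f u).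
Qed.

Lemma smooth_expr_is_derive f i : smooth_expr f ->
  exists2 g, smooth_expr g & forall u, W u -> is_derive u (delta_mx 0 i) f (g u).
Proof.
elim=> {f} [f sf|f g _ [f' sf' ff'] _ [g' sg' gg']
  |f g sf [f' sf' ff'] sg [g' sg' gg']|k f sf [f' sf' ff']].
- exists (pd i f); first exact/SmoothAtom/smooth_on_pd.
  by move=> u Wu; have [_ fd] := sf [::] u Wu; exact/derivableP.
- exists (f' + g'); first exact: SmoothAdd.
  by move=> u Wu; apply: is_deriveD; [exact: ff'|exact: gg'].
- exists (f * g' + g * f'); first by apply: SmoothAdd; apply: SmoothMul.
  move=> u Wu; rewrite /GRing.add /=.
  by apply: is_deriveM; [exact: ff'|exact: gg'].
- exists (((fun u => flat k.+2 (f u)) + cst (- k%:R) * (fun u => flat k.+1 (f u)))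
          * f').
    apply: SmoothMul => //; apply: SmoothAdd; first exact: SmoothFlat.
    apply: SmoothMul; last exact: SmoothFlat.
    by apply: SmoothAtom; exact: smooth_on_cst.
  move=> u Wu; have := is_derive_flat_comp k (ff' u Wu).
  by rewrite -mulNr.
Qed.

Lemma smooth_expr_smooth f : smooth_expr f -> smooth_on W f.
Proof.
move: f; apply: (smooth_on_coind (P := smooth_expr)) => [f u sf Wu|f i sf].
- split=> [|i]; first exact: smooth_expr_continuous.
  by have [g _ /(_ u Wu)[]] := smooth_expr_is_derive i sf.
- have [g sg fg] := smooth_expr_is_derive i sf; exists g => // u /set_mem Wu.
  by have [_ ->] := fg u Wu.
Qed.

Lemma smooth_onD f g : smooth_on W f -> smooth_on W g ->
  smooth_on W (fun u => f u + g u).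
Proof.
move=> sf sg; apply: (@smooth_expr_smooth (f + g)).
by apply: SmoothAdd; apply: SmoothAtom.
Qed.

Lemma smooth_onM f g : smooth_on W f -> smooth_on W g ->
  smooth_on W (fun u => f u * g u).
Proof.
move=> sf sg; apply: (@smooth_expr_smooth (f * g)).
by apply: SmoothMul; apply: SmoothAtom.
Qed.

Lemma smooth_on_flat k f : smooth_on W f -> smooth_on W (fun u => flat k (f u)).
Proof. by move=> sf; apply/smooth_expr_smooth/SmoothFlat/SmoothAtom. Qed.

Lemma smooth_on_sum m (f : 'I_m -> 'rV[R]_n -> R^o) :
  (forall l, smooth_on W (f l)) -> smooth_on W (fun u => \sum_l f l u).
Proof.
elim: m f => [|m IH] f sf.
  rewrite (_ : (fun u => _) = fun=> 0); first exact: smooth_on_cst.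
  by apply/funext=> u; rewrite big_ord0.
rewrite (_ : (fun u => _) =
    fun u => f ord0 u + \sum_(l < m) f (lift ord0 l) u); last first.
  by apply/funext=> u; rewrite big_ord_recl.
by apply: smooth_onD => //; apply: IH.
Qed.

End SmoothCalculus.

(** * Bump functions on manifolds *)

Section ManifoldFunctions.
Variables (R : realType) (M : manifold R).
Implicit Types (U V : set M) (f g : M -> R).

(** Openness is what makes smoothness in a chart a local matter, so that the
    closure properties above apply. *)
Lemma chart_image_open (a : mchart M) U :
  open U -> open (mcoord a @` (mdom a `&` U)).
Proof.
move=> oU; rewrite openE => _ [y [ay Uy] <-].
have ny : nbhs (mcoord a y) (mcoord a @` mdom a).
  by apply: open_nbhs_nbhs; split; [exact: m_img_open|exists y].
have nU : nbhs (mpar a (mcoord a y)) (mdom a `&` U).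
  rewrite m_coordK //; apply: open_nbhs_nbhs; split => //.
  by apply: openI => //; exact: m_dom_open.
have npU : nbhs (mcoord a y) (mpar a @^-1` (mdom a `&` U)).
  by apply: m_par_cont nU; exists y.
apply: filterS2 ny npU => _ [z az <-]; rewrite /= m_coordK // => -[_ Uz].
by exists z.
Qed.

Lemma msmooth_on_sub U V f : U `<=` V -> msmooth_on V f -> msmooth_on U f.
Proof.
by move=> UV sf a s _ [y [ay Uy] <-]; apply: sf; exists y => //; split=> //; exact: UV.
Qed.

Lemma msmooth_onU U V f :
  msmooth_on U f -> msmooth_on V f -> msmooth_on (U `|` V) f.
Proof.
by move=> sU sV a s _ [y [ay [Uy|Vy]] <-]; [apply: sU|apply: sV]; exists y.
Qed.

Lemma msmooth_on_eq U f g : open U -> (forall y, U y -> f y = g y) ->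
  msmooth_on U f -> msmooth_on U g.
Proof.
move=> oU fg sf a; apply: smooth_on_eq (sf a); first exact: chart_image_open.
by move=> u /set_mem[y [ay Uy] <-]; rewrite m_coordK // fg.
Qed.

Lemma msmooth_on_cst U (c : R) : open U -> msmooth_on U (fun=> c).
Proof. by move=> oU a; apply: smooth_on_cst; exact: chart_image_open. Qed.

Lemma msmooth_onD U f g : open U -> msmooth_on U f -> msmooth_on U g ->
  msmooth_on U (fun y => f y + g y).
Proof.
move=> oU sf sg a; exact: (smooth_onD (chart_image_open oU) (sf a) (sg a)).
Qed.

Lemma msmooth_onM U f g : open U -> msmooth_on U f -> msmooth_on U g ->
  msmooth_on U (fun y => f y * g y).
Proof.
move=> oU sf sg a; exact: (smooth_onM (chart_image_open oU) (sf a) (sg a)).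
Qed.

Lemma msmooth_on_sum U m (f : 'I_m -> M -> R) : open U ->
  (forall l, msmooth_on U (f l)) -> msmooth_on U (fun y => \sum_l f l y).
Proof.
move=> oU sf a.
have oW := chart_image_open (a := a) oU.
exact: (smooth_on_sum (f := fun l u => f l (mpar a u)) oW (fun l => sf l a)).
Qed.

Lemma msmooth_on_flat U k f : open U -> msmooth_on U f ->
  msmooth_on U (fun y => flat k (f y)).
Proof.
move=> oU sf a.
exact: (smooth_on_flat (f := fun u => f (mpar a u)) (chart_image_open oU) k (sf a)).
Qed.

Lemma msmooth_on_coord (a : mchart M) i :
  msmooth_on (mdom a) (fun y => mcoord a y 0 i).
Proof. by move=> b; exact: m_transition. Qed.

(** In a chart, with [c] the coordinates of [x], the bump is a flat function of [r^2 - |u - c|^2].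
    It vanishes off the cube of radius [r], whose image in the manifold is
    compact, hence closed because the manifold is Hausdorff; this is why
    extension by zero outside the chart is smooth.  The conclusion provides an
    open [V] where the bump vanishes, rather than a support, since a function is
    then smooth as soon as it is smooth on [U] and on [V]. *)
Lemma bump_function U (x : M) : open U -> U x ->
  exists chi : M -> R, exists V : set M,
    [/\ msmooth chi, chi x = 1, open V, U `|` V = setT &
        forall y, V y -> chi y = 0].
Proof.
move=> oU Ux; have [a ax] := m_cover x.
pose c := mcoord a x.
have : nbhs c (mcoord a @` (mdom a `&` U)).
  by apply: open_nbhs_nbhs; split; [exact: chart_image_open|exists x].
move=> /nbhs_ballP[e e0 eU].
pose r := e / 2; have r0 : 0 < r by rewrite divr_gt0.
pose K := [set u : 'rV[R]_(mdim M) | forall i, `[c 0 i - r, c 0 i + r]%classic (u 0 i)].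
have KU : K `<=` mcoord a @` (mdom a `&` U).
  move=> u Ku; apply: eU; split=> // i j; rewrite [i]ord1 /ball /= distrC.
  apply: (@le_lt_trans _ _ r).
    by rewrite ler_distl; have := Ku j; rewrite /= in_itv.
  by rewrite ltr_pdivrMr // ltr_pMr // ltr1n.
have cK : compact (mpar a @` K).
  apply: continuous_compact.
    apply: continuous_in_subspaceT => u /set_mem /KU[y [ay _] <-].
    by apply: m_par_cont; exists y.
  apply: (@rV_compact _ _ (fun i => `[c 0 i - r, c 0 i + r]%classic)).
  by move=> i; exact: segment_compact.
pose V := ~` (mpar a @` K).
have oV : open V.
  by rewrite openC; apply: compact_closed cK; exact: m_hausdorff.
pose q (y : M) := r ^+ 2 + -1 *
  \sum_i (mcoord a y 0 i + - c 0 i) * (mcoord a y 0 i + - c 0 i).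
pose b (y : M) : R := if `[< mdom a y >] then flat 0 (q y) else 0.
have bV y : V y -> b y = 0.
  move=> Vy; rewrite /b; case: asboolP => // ay; apply: flat_eq0.
  have : ~ K (mcoord a y) 
    by move=> Ky; apply: Vy; exists (mcoord a y); rewrite ?m_coordK.
  move=> /existsNP[i /negP]; rewrite in_itv /= -ler_distl -ltNge => ri.
  rewrite /q mulN1r subr_le0 (bigD1 i) //= -[_ ^+ 2]addr0.
  apply: lerD; last by apply: sumr_ge0 => l _; exact: sqr_ge0.
  rewrite -expr2 -[leRHS]real_normK ?num_real //.
  by apply: lerXn2r; rewrite ?nnegrE ?(ltW r0) ?(ltW ri).
have sb : msmooth b.
  rewrite /msmooth; have -> : [set: M] = mdom a `|` V.
    rewrite eqEsubset; split=> // y _.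
    have [ay|nay] := pselect (mdom a y); first by left.
    right=> -[u /KU[z [az _] <-]]; rewrite m_coordK // => zy.
    by apply: nay; rewrite -zy.
  apply: msmooth_onU; last first.
    by apply: (@msmooth_on_eq _ (fun=> 0)); [|move=> y /bV|exact: msmooth_on_cst].
  have oa := m_dom_open a.
  apply: (@msmooth_on_eq _ (fun y => flat 0 (q y))) => //.
    by move=> y ay; rewrite /b asboolT.
  apply: msmooth_on_flat => //; apply: msmooth_onD => //; first exact: msmooth_on_cst.
  apply: msmooth_onM => //; first exact: msmooth_on_cst.
  apply: msmooth_on_sum => // l.
  by apply: msmooth_onM => //; (apply: msmooth_onD => //; last exact: msmooth_on_cst);
    exact: msmooth_on_coord.
have bx : 0 < b x.
  rewrite /b asboolT //; apply: flat_gt0.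
  by rewrite /q big1 ?mulr0 ?addr0 ?exprn_gt0 // => i _; rewrite subrr mulr0.
exists (fun y => b y * (b x)^-1), V; split=> //.
- apply: msmooth_onM => //; first exact: openT.
  by apply: msmooth_on_cst; exact: openT.
- by rewrite divff // gt_eqF.
- rewrite eqEsubset; split=> // y _; have [Uy|nUy] := pselect (U y); first by left.
  right=> -[u /KU[z [az Uz] <-]]; rewrite m_coordK // => zy.
  by apply: nUy; rewrite -zy.
- by move=> y /bV ->; rewrite mul0r.
Qed.

End ManifoldFunctions.

(** * Sections of vector bundles and their brackets *)

Lemma eq_addrr_eq0 (V : zmodType) (v : V) : v = v + v -> v = 0.
Proof. by move=> /esym/eqP; rewrite -subr_eq0 addrK => /eqP. Qed.

Section Sections.
Variables (R : realType) (M : manifold R) (E : vbundle M).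
Implicit Types (s t : forall x, E x) (f : M -> R).

Lemma section_smooth_add s t : section_smooth s -> section_smooth t ->
  section_smooth (fun y => s y + t y).
Proof.
move=> ss st a i; have oa := v_dom_open a.
apply: msmooth_on_eq (msmooth_onD oa (ss a i) (st a i)) => // y _.
by rewrite linearD mxE.
Qed.

Lemma section_smooth_scale f s : msmooth f -> section_smooth s ->
  section_smooth (fun y => f y *: s y).
Proof.
move=> sf ss a i; have oa := v_dom_open a.
have fa : msmooth_on (vdom a) f by exact: msmooth_on_sub sf.
apply: msmooth_on_eq (msmooth_onM oa fa (ss a i)) => // y _.
by rewrite linearZ mxE.
Qed.

Lemma section_smoothZ (c : R) s : section_smooth s ->
  section_smooth (fun y => c *: s y).
Proof. by apply: section_smooth_scale; apply: msmooth_on_cst; exact: openT. Qed.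

Lemma section_smoothN s : section_smooth s -> section_smooth (fun y => - s y).
Proof.
move=> ss; rewrite (_ : (fun y => _) = fun y => -1 *: s y).
  exact: section_smoothZ.
by apply/functional_extensionality_dep => y; rewrite scaleN1r.
Qed.

Lemma section_smooth0 : section_smooth (fun y => 0 : E y).
Proof.
move=> a i; have oa := v_dom_open a.
apply: msmooth_on_eq (msmooth_on_cst 0 oa) => // y _.
by rewrite linear0 mxE.
Qed.

Lemma section_smooth_sum m (s : 'I_m -> forall x, E x) :
  (forall l, section_smooth (s l)) -> section_smooth (fun y => \sum_l s l y).
Proof.
elim: m s => [|m IH] s ss.
  rewrite (_ : (fun y => _) = fun y => 0); first exact: section_smooth0.
  by apply/functional_extensionality_dep => y; rewrite big_ord0.
rewrite (_ : (fun y => _) = fun y => s ord0 y + \sum_(l < m) s (lift ord0 l) y).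
  by apply: section_smooth_add => //; exact: IH.
by apply/functional_extensionality_dep => y; rewrite big_ord_recl.
Qed.

(** Multiplied by a bump, a function smooth near the support of the bump becomes
    globally smooth, whatever its values elsewhere. *)
Lemma msmooth_cutoff U V f chi : open U -> open V -> U `|` V = setT ->
  msmooth chi -> (forall y, V y -> chi y = 0) -> msmooth_on U f ->
  @msmooth _ M (fun y => chi y * f y).
Proof.
move=> oU oV UV sc cV sf; rewrite /msmooth -UV; apply: msmooth_onU.
  exact: (msmooth_onM oU (msmooth_on_sub (@subsetT _ U) sc) sf).
apply: msmooth_on_eq (msmooth_on_cst 0 oV) => // y Vy.
by rewrite cV ?mul0r.
Qed.

Lemma section_smooth_cutoff (a : vtriv E) V chi (u : 'rV[R]_(vrank E)) :
  open V -> vdom a `|` V = setT -> msmooth chi -> (forall y, V y -> chi y = 0) ->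
  section_smooth (fun y => chi y *: vframe a y u).
Proof.
move=> oV aV sc cV b i.
have oa := v_dom_open a; have ob := v_dom_open b.
apply: (@msmooth_on_sub _ _ _ ((vdom a `&` vdom b) `|` (V `&` vdom b))).
  by move=> y yb; have : setT y by []; rewrite -aV => -[ya|yV]; [left|right].
apply: msmooth_onU.
  have sca : msmooth_on (vdom a `&` vdom b) chi by exact: msmooth_on_sub sc.
  have oab := openI oa ob.
  apply: msmooth_on_eq (msmooth_onM oab sca (@v_transition R M E a b u i)) => // y _.
  by rewrite linearZ mxE.
have oVb := openI oV ob.
apply: msmooth_on_eq (msmooth_on_cst 0 oVb) => // y [yV _].
by rewrite cV // scale0r linear0 mxE.
Qed.

(** Constant coordinates in a trivialisation, cut off by a bump. *)
Lemma section_extension (x : M) (v : E x) : exists2 s, section_smooth s & s x = v.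
Proof.
have [a ax] := v_cover E x.
have [chi [V [sc cx oV aV cV]]] := bump_function (v_dom_open a) ax.
exists (fun y => chi y *: vframe a y (vcoord a x v)).
  exact: section_smooth_cutoff oV aV sc cV.
by rewrite cx scale1r v_coordK.
Qed.

(** Near [x], a section vanishing at [x] is a combination of a local frame with
    coefficients vanishing at [x].  To make coefficients and frame globally
    smooth each of them receives one bump, whence the square of the bump. *)
Lemma vanishing_section (x : M) s : section_smooth s -> s x = 0 ->
  exists (chi : M -> R) m (f : 'I_m -> M -> R) (e : 'I_m -> forall y, E y),
    [/\ msmooth chi, chi x = 1,
        forall l, [/\ msmooth (f l), f l x = 0 & section_smooth (e l)] &
        forall y, chi y *: s y = \sum_l f l y *: e l y].
Proof.
move=> ss sx; have [a ax] := v_cover E x.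
have oa := v_dom_open a.
have [chi [V [sc cx oV aV cV]]] := bump_function oa ax.
exists (fun y => chi y * chi y), (vrank E),
  (fun l y => chi y * vcoord a y (s y) 0 l),
  (fun l y => chi y *: vframe a y (delta_mx 0 l)); split.
- exact: (msmooth_onM openT sc sc).
- by rewrite cx mulr1.
- move=> l; split.
  + exact: msmooth_cutoff oa oV aV sc cV (ss a l).
  + by rewrite sx linear0 mxE mulr0.
  + exact: section_smooth_cutoff oV aV sc cV.
- move=> y; have : setT y by []; rewrite -aV => -[ya|/cV cy]; last first.
    by rewrite cy mul0r scale0r big1 // => l _; rewrite mul0r scale0r.
  apply: (can_inj (v_coordK ya)); rewrite linearZ linear_sum /=.
  rewrite {1}[vcoord a y (s y)]row_sum_delta scaler_sumr; apply: eq_bigr => l _.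
  rewrite [RHS]linearZ [X in _ *: X = _]/= [vcoord a y (chi y *: _)]linearZ /=.
  by rewrite v_frameK // !scalerA mulrAC.
Qed.

End Sections.

Section Brackets.
Variables (R : realType) (M : manifold R) (A : lie_algebroid M).
Implicit Types (s t u : forall x, A x) (f : M -> R).

Lemma bracketDr u s t x : section_smooth u -> section_smooth s -> section_smooth t ->
  bracket u (fun y => s y + t y) x = bracket u s x + bracket u t x.
Proof.
move=> su ss st; rewrite (bracket_antisym x su (section_smooth_add ss st)).
have -> : (fun y => s y + t y) = (fun y => 1 *: s y + t y).
  by apply/functional_extensionality_dep => y; rewrite scale1r.
rewrite (bracket_linear 1 x ss st su) scale1r opprD.
by rewrite -(bracket_antisym x su ss) -(bracket_antisym x su st).
Qed.

Lemma bracketDl u s t x : section_smooth u -> section_smooth s -> section_smooth t ->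
  bracket (fun y => s y + t y) u x = bracket s u x + bracket t u x.
Proof.
move=> su ss st; rewrite (bracket_antisym x (section_smooth_add ss st) su).
rewrite (bracketDr x su ss st) opprD.
by rewrite -(bracket_antisym x ss su) -(bracket_antisym x st su).
Qed.

Lemma bracket0r u x : section_smooth u -> bracket u (fun y => 0) x = 0.
Proof.
move=> su; have s0 := section_smooth0 (E := A).
have := bracketDr x su s0 s0.
rewrite (_ : (fun y => 0 + 0) = fun y => 0); last first.
  by apply/functional_extensionality_dep => y; rewrite addr0.
exact: eq_addrr_eq0.
Qed.

Lemma bracketNr u s x : section_smooth u -> section_smooth s ->
  bracket u (fun y => - s y) x = - bracket u s x.
Proof.
move=> su ss; apply/eqP; rewrite -addr_eq0 addrC.
rewrite -(bracketDr x su ss (section_smoothN ss)).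
rewrite (_ : (fun y => s y - s y) = fun y => 0); last first.
  by apply/functional_extensionality_dep => y; rewrite subrr.
by rewrite (bracket0r x su).
Qed.

Lemma bracketNl u s x : section_smooth u -> section_smooth s ->
  bracket (fun y => - s y) u x = - bracket s u x.
Proof.
move=> su ss; rewrite (bracket_antisym x (section_smoothN ss) su).
by rewrite (bracketNr x su ss) -(bracket_antisym x ss su).
Qed.

Lemma bracketDD s1 s2 t1 t2 x :
  section_smooth s1 -> section_smooth s2 -> section_smooth t1 -> section_smooth t2 ->
  bracket (fun y => s1 y + s2 y) (fun y => t1 y + t2 y) x
  = bracket s1 t1 x + bracket s1 t2 x + (bracket s2 t1 x + bracket s2 t2 x).
Proof.
move=> ss1 ss2 st1 st2; rewrite (bracketDl x (section_smooth_add st1 st2) ss1 ss2).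
by rewrite (bracketDr x ss1 st1 st2) (bracketDr x ss2 st1 st2).
Qed.

Lemma bracketBB s1 s2 t1 t2 x :
  section_smooth s1 -> section_smooth s2 -> section_smooth t1 -> section_smooth t2 ->
  bracket (fun y => s1 y - s2 y) (fun y => t1 y - t2 y) x
  = bracket s1 t1 x - bracket s1 t2 x + (- bracket s2 t1 x + bracket s2 t2 x).
Proof.
move=> ss1 ss2 st1 st2.
have sn2 := section_smoothN ss2; have tn2 := section_smoothN st2.
rewrite (bracketDD x ss1 sn2 st1 tn2) (bracketNr x ss1 st2).
by rewrite (bracketNl x st1 ss2) (bracketNl x tn2 ss2) (bracketNr x ss2 st2) opprK.
Qed.

Lemma bracket_sumr u m (s : 'I_m -> forall y, A y) x :
  section_smooth u -> (forall l, section_smooth (s l)) ->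
  bracket u (fun y => \sum_l s l y) x = \sum_l bracket u (s l) x.
Proof.
move=> su; elim: m s => [|m IH] s ss.
  rewrite (_ : (fun y => _) = fun y => 0) ?big_ord0 ?bracket0r //.
  by apply/functional_extensionality_dep => y; rewrite big_ord0.
rewrite (_ : (fun y => _) = fun y => s ord0 y + \sum_(l < m) s (lift ord0 l) y).
  have st := section_smooth_sum (fun l => ss (lift ord0 l)).
  rewrite (bracketDr x su (ss ord0) st) big_ord_recl.
  by rewrite (IH _ (fun l => ss (lift ord0 l))).
by apply/functional_extensionality_dep => y; rewrite big_ord_recl.
Qed.

(** The bracket with [t] is a derivation over the anchor of [t], so where that
    anchor vanishes it is linear over functions, and depends on the value of
    its other argument only. *)
Lemma bracket_vanish t s x : section_smooth t -> section_smooth s ->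
  anchor A x (t x) = 0 -> s x = 0 -> bracket t s x = 0.
Proof.
move=> st ss t0 s0.
have [chi [m [f [e [sc cx fe es]]]]] := vanishing_section ss s0.
have := bracket_leibniz x sc st ss.
rewrite cx s0 scaler0 addr0 scale1r => <-.
have -> : (fun y => chi y *: s y) = (fun y => \sum_l f l y *: e l y).
  by apply/functional_extensionality_dep.
have sfe l : section_smooth (fun y => f l y *: e l y).
  by have [sf _ se] := fe l; exact: section_smooth_scale.
rewrite (bracket_sumr x st sfe).
apply: big1 => l _; have [sf fx se] := fe l.
by rewrite (bracket_leibniz x sf st se) fx t0 scale0r add0r /lie_deriv /= scale0r.
Qed.

(** The anchor preserves brackets; here is the case where [t] lies in its kernel.
    Expand the Jacobi identity for [s], [t] and [f u] by the Leibniz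
    rule: the terms that differentiate [f] once more leave
    [#[s,t](f) u = 0].  Taking [u = [s,t]] itself makes [u] nonzero at the point,
    unless there is nothing to prove. *)
Lemma anchor_bracket_isotropy s t : section_smooth s -> isotropy_section t ->
  isotropy_section (bracket s t).
Proof.
move=> ss [st t0]; split=> [|x]; first exact: bracket_smooth.
have sst := bracket_smooth ss st.
have [->|/eqP stx] := pselect (bracket s t x = 0); first by rewrite linear0.
suff K f : msmooth f -> lie_deriv (anchor A x (bracket s t x)) f = 0.
  (* Derivations are extended by zero to the functions that are not smooth. *)
  apply/val_inj/funext => f /=; have [sf|nf] := pselect (msmooth f); first exact: K.
  have /asboolP[_ _ ->//] := valP (anchor A x (bracket s t x)).
move=> sf; pose u := bracket s t; have su : section_smooth u by [].
pose w y := f y *: u y; have sw : section_smooth w by exact: section_smooth_scale.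
pose sf' y := lie_deriv (anchor A y (s y)) f.
have ssf' : msmooth sf' by exact: anchor_smooth.
have tw : bracket t w = fun y => f y *: bracket t u y.
  apply/functional_extensionality_dep => y.
  by rewrite (bracket_leibniz y sf st su) t0 /lie_deriv /= scale0r addr0.
have sw' : bracket w s = fun y => - (f y *: bracket s u y + sf' y *: u y).
  apply/functional_extensionality_dep => y.
  by rewrite (bracket_antisym y sw ss) (bracket_leibniz y sf ss su).
have stu := bracket_smooth st su; have ssu := bracket_smooth ss su.
have J1 : bracket s (bracket t w) x =
    f x *: bracket s (bracket t u) x + sf' x *: bracket t u x.
  by rewrite tw (bracket_leibniz x sf ss stu).
have J2 : bracket t (bracket w s) x =
    - (f x *: bracket t (bracket s u) x + sf' x *: bracket t u x).
  have s1 := section_smooth_scale sf ssu; have s2 := section_smooth_scale ssf' su.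
  rewrite sw' (bracketNr x st (section_smooth_add s1 s2)) (bracketDr x st s1 s2).
  rewrite (bracket_leibniz x sf st ssu) (bracket_leibniz x ssf' st su) t0.
  by rewrite /lie_deriv /= !scale0r !addr0.
have J3 : bracket w (bracket s t) x =
    - (f x *: bracket (bracket s t) u x
       + lie_deriv (anchor A x (bracket s t x)) f *: u x).
  by rewrite (bracket_antisym x sw sst) (bracket_leibniz x sf sst su).
have J := bracket_jacobi x ss st sw; have J' := bracket_jacobi x ss st su.
have us : bracket u s = fun y => - bracket s u y.
  by apply/functional_extensionality_dep => y; exact: bracket_antisym y su ss.
move: J J'; rewrite J1 J2 J3 us (bracketNr x st ssu) -/u => J.
rewrite (bracket_antisym x su su) => J'.
have : lie_deriv (anchor A x (u x)) f *: u x = 0.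
  move: J; rewrite [in X in _ + X]opprD addrA [- (_ + _)]opprD addrACA subrr addr0.
  rewrite -!scalerN -!scalerDr J' scaler0 add0r => /eqP.
  by rewrite scalerN oppr_eq0 => /eqP.
move=> /eqP; rewrite scaler_eq0 (negPf stx) orbF => /eqP; apply.
Qed.

End Brackets.

(** * Sums over pairs of indices, and classes modulo the isotropy *)

Section Combinatorics.

Lemma front_map (V V' : Type) k (f : V -> V') (b : V) (s : seq V) :
  (fun m => f (front (k := k) b s m)) = front (f b) [seq f v | v <- s].
Proof.
apply/funext=> m; rewrite /front -map_cons.
have [ms|sm] := ltnP m (size (b :: s)); first by rewrite (nth_map b).
by rewrite !nth_default ?size_map.
Qed.

(** The default value of [nth] in [front] is the first argument itself, so that
    [front] is linear in it only when no index is out of range; hence the size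
    condition. *)
Lemma front_linear (R : realType) (V : lmodType R) k (phi : ('I_k -> V) -> R)
    (s : seq V) (c : R) (u v : V) :
  alternating_multilinear phi -> (0 < k)%N -> size s = k.-1 ->
  phi (front (c *: u + v) s) = c * phi (front u s) + phi (front v s).
Proof.
case: k phi => // k phi [mphi _] _ /= ss.
have E (b : V) : front b s = (fun l : 'I_k.+1 => if l == ord0 then b else s`_l.-1).
  apply/funext=> -[[|m] mk] //=; rewrite /front /=.
  by apply: set_nth_default; rewrite ss.
by rewrite !E mphi.
Qed.

Lemma enum_lift k (i : 'I_k.+1) :
  [seq l <- enum 'I_k.+1 | l != i] = [seq lift i m | m <- enum 'I_k].
Proof.
have srt n : sorted ltn [seq val m | m <- enum 'I_n].
  by rewrite val_enum_ord iota_ltn_sorted.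
apply: (inj_map val_inj); apply: (irr_sorted_eq ltn_trans ltnn).
- exact: subseq_sorted ltn_trans _ _ (map_subseq _ (filter_subseq _ _)) (srt _).
- rewrite -map_comp (map_comp (bump i) val).
  apply: homo_sorted (srt k) => p q pq.
  by rewrite ltnNge leq_bump2 -ltnNge.
- apply: eq_mem_map => m; rewrite mem_filter mem_enum andbT.
  apply/idP/mapP => [|[l _ ->]]; last by rewrite eq_sym neq_lift.
  by case: (unliftP i m) => [l ->|->]; [exists l; rewrite ?mem_enum|rewrite eqxx].
Qed.

Lemma enum_lift2 k (i : 'I_k.+1) (r : 'I_k) :
  [seq l <- enum 'I_k.+1 | (l != i) && (l != lift i r)] =
  [seq lift i m | m <- enum 'I_k & m != r].
Proof.
have -> : [seq l <- enum 'I_k.+1 | (l != i) && (l != lift i r)] =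
    [seq l <- [seq l <- enum 'I_k.+1 | l != i] | l != lift i r].
  by rewrite -filter_predI; apply: eq_filter => l /=; rewrite andbC.
rewrite enum_lift filter_map; congr map; apply: eq_filter => m /=.
by rewrite (inj_eq lift_inj).
Qed.

Lemma size_enum_neq2 k (p q : 'I_k.+1) : p != q ->
  size [seq l <- enum 'I_k.+1 | (l != p) && (l != q)] = k.-1.
Proof.
case: (unliftP p q) => [r ->|->]; last by rewrite eqxx.
rewrite enum_lift2 size_map => _; case: k r {p q} => [[]//|k] r.
by rewrite enum_lift size_map size_enum_ord.
Qed.

Lemma sum_lift (V : zmodType) k (i : 'I_k.+1) (H : 'I_k.+1 -> V) :
  \sum_(l < k) H (lift i l) = \sum_(m | m != i) H m.
Proof.
apply: (addrI (H i)); rewrite -[RHS](bigD1 (op := +%R) i (P := predT)) //.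
exact/esym/(bigD1_ord (op := +%R) i (P := predT)).
Qed.

(** Deleting [i] and then the [l]-th of the remaining indices deletes the pair
    [i], [lift i l]; each pair [p < q] arises twice, with opposite signs, since
    deleting [p] first lowers the rank of [q] by one. *)
Lemma sum_pairs_sign (R : comNzRingType) k (G : 'I_k.+1 -> 'I_k.+1 -> R) :
  \sum_(i < k.+1) (-1) ^+ i * \sum_(l < k) (-1) ^+ l * G i (lift i l) =
  \sum_(p < k.+1) \sum_(q < k.+1 | (p < q)%N) (-1) ^+ (p + q) * (G q p - G p q).
Proof.
pose H (i m : 'I_k.+1) : R := (-1) ^+ (i + unbump i m) * G i m.
have -> : \sum_(i < k.+1) (-1) ^+ i * \sum_(l < k) (-1) ^+ l * G i (lift i l) =
    \sum_(i < k.+1) (\sum_(m < k.+1 | (m < i)%N) (-1) ^+ (m + i) * G i m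
                    - \sum_(m < k.+1 | (i < m)%N) (-1) ^+ (i + m) * G i m).
  apply: eq_bigr => i _; rewrite mulr_sumr.
  rewrite (eq_bigr (fun l => H i (lift i l))) => [|l _]; last first.
    by rewrite /H /= bumpK exprD mulrA.
  rewrite sum_lift (bigID (fun m : 'I_k.+1 => (m < i)%N)) /= -sumrN.
  congr (_ + _); apply: eq_big => [m|m].
  + by rewrite -val_eqE /=; case: ltngtP.
  + by move=> /andP[_ mi]; rewrite /H /unbump ltnNge (ltnW mi) subn0 addnC.
  + by rewrite -val_eqE /=; case: ltngtP.
  + rewrite -val_eqE -leqNgt /= => /andP[ne le].
    have im : (i < m)%N by rewrite ltn_neqAle eq_sym ne.
    rewrite /H /unbump im subn1 -mulNr; congr (_ * _).
    by case: (val m) im => // n _; rewrite addnS exprS mulN1r opprK.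
rewrite sumrB (exchange_big_dep predT) //= -sumrB; apply: eq_bigr => p _.
by rewrite -sumrB; apply: eq_bigr => q _; rewrite mulrBr.
Qed.

End Combinatorics.

Section Classes.
Variables (R : realType) (M : manifold R).
Variables (A B : lie_algebroid M) (j : subalgebroid B A) (x : M).

Lemma val_kernel (a : A x) : anchor A x a = 0 ->
  \val (insubd (0 : isotropy A x) a) = a.
Proof. by move=> a0; apply: insubdK; rewrite inE a0. Qed.

Lemma cls_linear (c : R) (a b : A x) : anchor A x a = 0 -> anchor A x b = 0 ->
  cls j (c *: a + b) = c *: cls j a + cls j b.
Proof.
move=> a0 b0; rewrite /cls.
have -> : insubd (0 : isotropy A x) (c *: a + b) =
    c *: insubd (0 : isotropy A x) a + insubd (0 : isotropy A x) b.
  apply: val_inj; rewrite val_kernel ?linearP ?a0 ?b0 ?scaler0 ?addr0 //.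
  by rewrite /= !val_kernel.
by rewrite quotmod_piD quotmod_piZ.
Qed.

Lemma clsD (a b : A x) : anchor A x a = 0 -> anchor A x b = 0 ->
  cls j (a + b) = cls j a + cls j b.
Proof. by move=> a0 b0; rewrite -[a]scale1r cls_linear // !scale1r. Qed.

(** The class is a genuine one only on the kernel of the anchor; elsewhere it is
    a junk value, which is why anchors have to be tracked throughout. *)
Lemma cls_eqP (a b : A x) : anchor A x a = 0 -> anchor A x b = 0 ->
  cls j a = cls j b <-> exists2 h : B x, anchor B x h = 0 & j x h = a - b.
Proof.
move=> a0 b0; rewrite /cls quotmod_pi_eq.
split=> [/asboolP[h h0 jh]|[h h0 jh]]; last
  apply/asboolP; exists h => //; rewrite jh /=.
- by rewrite !val_kernel.
- by rewrite !val_kernel.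
Qed.

Lemma cls0 : cls j (0 : A x) = 0.
Proof.
have := clsD (linear0 (anchor A x)) (linear0 (anchor A x)).
by rewrite addr0; exact: eq_addrr_eq0.
Qed.

Lemma clsN (a : A x) : anchor A x a = 0 -> cls j (- a) = - cls j a.
Proof.
move=> a0; apply/eqP; rewrite -addr_eq0 -clsD ?addNr ?cls0 //.
by rewrite linearN a0 oppr0.
Qed.

Lemma cls_incl (h : B x) : anchor B x h = 0 -> cls j (j x h) = 0.
Proof.
move=> h0; rewrite -cls0; apply/cls_eqP; rewrite ?conn_anchor ?linear0 //.
by exists h; rewrite ?addr0.
Qed.

End Classes.

(** * The differentials of invariant forms *)

Section Isotropy.
Variables (R : realType) (M : manifold R) (A : lie_algebroid M).
Implicit Types (s t : forall x, A x).

Lemma isotropy_sectionD s t : isotropy_section s -> isotropy_section t ->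
  isotropy_section (fun y => s y + t y).
Proof.
move=> [ss s0] [st t0]; split; first exact: section_smooth_add.
by move=> x; rewrite linearD s0 t0 addr0.
Qed.

Lemma anchor_eq0D x (a b : A x) : anchor A x a = 0 -> anchor A x b = 0 ->
  anchor A x (a + b) = 0.
Proof. by move=> a0 b0; rewrite linearD a0 b0 addr0. Qed.

Lemma anchor_eq0N x (a : A x) : anchor A x a = 0 -> anchor A x (- a) = 0.
Proof. by move=> a0; rewrite linearN a0 oppr0. Qed.

(** By [bracket_vanish] in each argument: the isotropy bundle is a bundle of Lie
    algebras. *)
Lemma bracket_isotropy_congr s s' t t' x :
  isotropy_section s -> isotropy_section s' -> s x = s' x ->
  isotropy_section t -> isotropy_section t' -> t x = t' x ->
  bracket s t x = bracket s' t' x.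
Proof.
have congr2 (u v w : forall y, A y) : isotropy_section u -> isotropy_section v ->
    isotropy_section w -> v x = w x -> bracket u v x = bracket u w x.
  move=> [su u0] [sv v0] [sw w0] vw; apply/eqP; rewrite -subr_eq0.
  have sN := section_smoothN sw.
  rewrite -(bracketNr x su sw) -(bracketDr x su sv sN); apply/eqP.
  apply: (bracket_vanish su (section_smooth_add sv sN) (u0 x)).
  by rewrite vw subrr.
move=> si si' ss ti ti' tt; have [s1 _] := si; have [s2 _] := si'.
have [t1 _] := ti; have [t2 _] := ti'.
rewrite (congr2 s t t') // bracket_antisym // [RHS]bracket_antisym //.
by rewrite (congr2 t' s s').
Qed.

End Isotropy.

(** Classes are additive on the kernel of the anchor only; this discharges the
    resulting side conditions. *)
Ltac anchor0 := by repeat first [assumption | apply: anchor_eq0D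
  | apply: anchor_eq0N | rewrite conn_anchor].


Section Pair.
Variables (R : realType) (M : manifold R).
Variables (A B : lie_algebroid M) (j : subalgebroid B A).
Variables (k : nat) (Psi : Qform j k).
Arguments Psi : clear implicits.
Hypothesis Psi_form : is_Qform Psi.
Hypothesis Psi_inv : B_invariant Psi.

Lemma incl_smooth (beta : forall x, B x) : section_smooth beta ->
  section_smooth (fun y => j y (beta y)).
Proof. exact: conn_smooth. Qed.

Definition other_classes (nu : 'I_k.+1 -> forall x, A x) (p q : 'I_k.+1) x :=
  [seq cls j (nu l x) | l <- enum 'I_k.+1 & (l != p) && (l != q)].

Lemma other_classes_linear nu (p q : 'I_k.+1) x c u v : (p < q)%N ->
  Psi x (front (c *: u + v) (other_classes nu p q x))
  = c * Psi x (front u (other_classes nu p q x))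
    + Psi x (front v (other_classes nu p q x)).
Proof.
move=> pq; apply: front_linear; first by case: Psi_form.
  by apply: leq_ltn_trans (leq_trans pq (leq_ord q)).
by rewrite size_map size_enum_neq2 // -val_eqE /= ltn_eqF.
Qed.

Lemma other_classesB nu (p q : 'I_k.+1) x u v : (p < q)%N ->
  Psi x (front (u - v) (other_classes nu p q x))
  = Psi x (front u (other_classes nu p q x)) - Psi x (front v (other_classes nu p q x)).
Proof. by move=> pq; rewrite addrC -scaleN1r other_classes_linear // mulN1r addrC. Qed.

(** Invariance turns the derivative part of the differential into bracket terms;
    [sum_pairs_sign] then collects, for each pair [p < q], the contributions
    where [beta q] acts on [nu p] and where [beta p] acts on [nu q]. *)
Lemma invariant_sum (beta : 'I_k.+1 -> forall x, B x)
    (nu : 'I_k.+1 -> forall x, A x) x :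
  (forall i, section_smooth (beta i)) -> (forall i, isotropy_section (nu i)) ->
  \sum_(i < k.+1) (-1) ^+ i * lie_deriv (anchor B x (beta i x))
      (fun y => Psi y (fun m => cls j (nu (lift i m) y)))
  = \sum_(p < k.+1) \sum_(q < k.+1 | (p < q)%N) (-1) ^+ (p + q) *
      (Psi x (front (cls j (bracket (fun y => j y (beta q y)) (nu p) x))
                    (other_classes nu p q x))
       - Psi x (front (cls j (bracket (fun y => j y (beta p y)) (nu q) x))
                      (other_classes nu p q x))).
Proof.
move=> sb inu.
pose G (i m : 'I_k.+1) : R :=
  Psi x (front (cls j (bracket (fun y => j y (beta i y)) (nu m) x))
              (other_classes nu i m x)).
have classesC p q : other_classes nu p q x = other_classes nu q p x.
  by rewrite /other_classes; congr map; apply: eq_filter => l; rewrite andbC.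
transitivity (\sum_(i < k.+1) (-1) ^+ i * \sum_(l < k) (-1) ^+ l * G i (lift i l)).
  apply: eq_bigr => i _; congr (_ * _).
  rewrite (Psi_inv x (sb i) (fun m => inu (lift i m))).
  by apply: eq_bigr => l _; rewrite /G /other_classes enum_lift2 -map_comp.
rewrite sum_pairs_sign; apply: eq_bigr => p _; apply: eq_bigr => q _.
by rewrite /G [other_classes nu q p x]classesC.
Qed.

Variables (F : foliation M) (lambda : splitting F B).
Hypothesis B_over_F : over_foliation B F.
Hypothesis A_over_F : over_foliation A F.

Lemma foliation_anchor (C : lie_algebroid M) x (a : C x) :
  over_foliation C F -> F x (anchor C x a).
Proof. by move=> ->; exists a. Qed.

Lemma split_anchor_smooth (C : lie_algebroid M) (s : forall x, C x) :
  over_foliation C F -> section_smooth s ->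
  section_smooth (fun y => lambda y (anchor C y (s y))).
Proof.
move=> CF ss; apply: split_smooth; first exact: anchor_smooth.
by move=> y; exact: foliation_anchor.
Qed.

(** Extend [h] to any section [s] of [B], then project to the kernel of the
    anchor along the splitting: [s - lambda(#s)]. *)
Lemma isotropy_extension x (h : B x) : anchor B x h = 0 ->
  exists2 beta, isotropy_section beta & beta x = h.
Proof.
move=> h0; have [s ss sx] := section_extension h.
exists (fun y => s y - lambda y (anchor B y (s y))).
  split.
    have sl := split_anchor_smooth B_over_F ss.
    exact: section_smooth_add ss (section_smoothN sl).
  by move=> y; rewrite linearB split_anchor ?subrr //; exact: foliation_anchor.
have F0 : F x 0 by rewrite -h0; exact: foliation_anchor.
have := split_linear lambda 1 F0 F0.
by rewrite sx h0 scale1r addr0 scale1r => /eq_addrr_eq0 ->; rewrite subr0.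
Qed.

(** If the classes of [nu i] and [nu' i] agree at [x], then [nu' i] has at [x]
    the value of [nu i + j (beta i)] for sections [beta i] of the kernel of the
    anchor of [B].  As brackets of isotropy sections are fibrewise, the two
    formulas differ by the terms [[j (beta p), nu q]], the terms
    [j [beta p, beta q]] being zero modulo the isotropy of [B].  By invariance
    these add up to derivatives along the anchors of the [beta i], which vanish. *)
Lemma bar_delta_formula_cls (nu nu' : 'I_k.+1 -> forall x, A x) x :
  (forall i, isotropy_section (nu i)) -> (forall i, isotropy_section (nu' i)) ->
  (forall i, cls j (nu' i x) = cls j (nu i x)) ->
  bar_delta_formula Psi nu' x = bar_delta_formula Psi nu x.
Proof.
move=> inu inu' nn.
have /fin_all_exists2[beta ibeta jbeta] i : exists2 beta, isotropy_section beta &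
    j x (beta x) = nu' i x - nu i x.
  have [_ /(_ x) n0] := inu i; have [_ /(_ x) n0'] := inu' i.
  have [h h0 jh] := (cls_eqP j n0' n0).1 (nn i).
  by have [beta ib bx] := isotropy_extension h0; exists beta; rewrite ?bx.
have sbeta i : section_smooth (beta i) by case: (ibeta i).
have ijb i : isotropy_section (fun y => j y (beta i y)).
  split; first exact: incl_smooth.
  by move=> y; rewrite conn_anchor; case: (ibeta i).
have := invariant_sum x sbeta inu.
rewrite big1 => [S0|i _]; last first.
  by have [_ ->] := ibeta i; rewrite /lie_deriv /= mulr0.
have brE p q : cls j (bracket (nu' p) (nu' q) x) = cls j (bracket (nu p) (nu q) x)
    - (cls j (bracket (fun y => j y (beta q y)) (nu p) x)
       - cls j (bracket (fun y => j y (beta p y)) (nu q) x)).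
  have [s1 _] := inu p; have [s2 _] := inu q.
  have j1 := incl_smooth (sbeta p); have j2 := incl_smooth (sbeta q).
  have iD i : isotropy_section (fun y => nu i y + j y (beta i y)).
    exact: isotropy_sectionD.
  have nuE i : nu' i x = nu i x + j x (beta i x) by rewrite jbeta addrC subrK.
  have -> := etrans (bracket_isotropy_congr (inu' p) (iD p) (nuE p)
    (inu' q) (iD q) (nuE q)) (bracketDD x s1 j1 s2 j2).
  rewrite (incl_flat j x (sbeta p) (sbeta q)) (bracket_antisym x s1 j2).
  have [_ /(_ x) ab] := anchor_bracket_isotropy (sbeta p) (ibeta q).
  have a1 := (anchor_bracket_isotropy s1 (inu q)).2 x.
  have a2 := (anchor_bracket_isotropy j1 (inu q)).2 x.
  have a3 := (anchor_bracket_isotropy j2 (inu p)).2 x.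
  rewrite !clsD ?clsN ?cls_incl; try anchor0.
  by rewrite addr0 opprB addrA addrAC.
have classesE p q : other_classes nu' p q x = other_classes nu p q x.
  by apply: eq_map => l; exact: nn.
apply/eqP; rewrite -subr_eq0 /bar_delta_formula -sumrB; apply/eqP.
rewrite [RHS]S0; apply: eq_bigr => p _; rewrite -sumrB.
apply: eq_bigr => q pq.
rewrite -/(other_classes nu' p q x) -/(other_classes nu p q x) classesE brE.
rewrite !other_classesB // exprS mulN1r.
by rewrite -mulrBr mulNr -mulrN addrAC subrr add0r opprK.
Qed.

Variables (L : lie_algebroid M) (nabla : connection L A).
Hypothesis nabla_flat : flat_connection nabla.

(** On [j c] the connection form is [j (c - lambda(#c))], which lies in the
    isotropy of [B]; on the isotropy of [A] it is the identity. *)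
Lemma cls_connection_form x (c : B x) (n : A x) : anchor A x n = 0 ->
  cls j (- connection_form j lambda (j x c + n)) = - cls j n.
Proof.
move=> n0; have Fc := foliation_anchor c B_over_F.
have lc : anchor B x (lambda x (anchor B x c)) = anchor B x c by exact: split_anchor.
rewrite /connection_form [anchor A x (_ + _)]linearD n0 addr0 conn_anchor -clsN //.
apply/cls_eqP; [|anchor0|].
  rewrite [LHS]linearN [anchor A x (_ - _)]linearB [anchor A x (_ + _)]linearD.
  by rewrite n0 addr0 !conn_anchor lc subrr oppr0.
exists (lambda x (anchor B x c) - c); first by rewrite linearB lc subrr.
by rewrite [LHS]linearB opprK opprB opprD addrA subrK.
Qed.

(** With [beta = lambda(# nabla xi)] one has [nabla xi = j beta - nu], and by
    flatness [nabla [xi p, xi q] = [nabla (xi p), nabla (xi q)]].  Hence omega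
    sends [[xi p, xi q]] to
    [[j (beta p), nu q] - [j (beta q), nu p] - [nu p, nu q]] modulo the isotropy
    of [B].  The first two terms cancel the derivative part of the differential,
    computed by [invariant_sum] since [# xi = # beta]; the last one is the
    summand of the algebraic differential. *)
Lemma dL_Delta_formula (xi : 'I_k.+1 -> forall x, L x) x :
  (forall i, section_smooth (xi i)) ->
  let nu i y := - connection_form j lambda (nabla y (xi i y)) in
  (forall i, isotropy_section (nu i)) /\
  dL_formula (Delta_hom lambda nabla Psi) xi x = bar_delta_formula Psi nu x.
Proof.
move=> sxi nu.
have ss i : section_smooth (fun y => nabla y (xi i y)) by exact: conn_smooth.
pose beta i y := lambda y (anchor A y (nabla y (xi i y))).
have sb i : section_smooth (beta i) by exact: split_anchor_smooth.
have anb i y : anchor B y (beta i y) = anchor A y (nabla y (xi i y)).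
  by rewrite split_anchor //; exact: foliation_anchor.
have inu i : isotropy_section (nu i).
  split.
    have sN := section_smoothN (incl_smooth (sb i)).
    exact: section_smoothN (section_smooth_add (ss i) sN).
  move=> y; apply: anchor_eq0N; rewrite /connection_form [LHS]linearB.
  by rewrite -/(beta i y) [anchor A y (j y _)]conn_anchor anb subrr.
split=> //; rewrite /dL_formula.
have -> : \sum_(i < k.+1) (-1) ^+ i * lie_deriv (anchor L x (xi i x))
    (fun y => Delta_hom lambda nabla Psi y (fun m => xi (lift i m) y)) =
  \sum_(i < k.+1) (-1) ^+ i * lie_deriv (anchor B x (beta i x))
    (fun y => Psi y (fun m => cls j (nu (lift i m) y))).
  by apply: eq_bigr => i _; rewrite anb conn_anchor.
rewrite invariant_sum // -big_split; apply: eq_bigr => p _ /=.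
rewrite -big_split; apply: eq_bigr => q pq /=.
rewrite /Delta_hom front_map -map_comp.
rewrite -[[seq _ | l <- _]]/(other_classes nu p q x).
rewrite -[X in front _ X]/(other_classes nu p q x).
have [snp _] := inu p; have [snq _] := inu q.
have jp := incl_smooth (sb p); have jq := incl_smooth (sb q).
have sE i : (fun y => nabla y (xi i y)) = (fun y => j y (beta i y) - nu i y).
  by apply/functional_extensionality_dep => y; rewrite /nu opprK addrC subrK.
have -> : omega j lambda nabla (bracket (xi p) (xi q) x) =
    cls j (bracket (fun y => j y (beta p y)) (nu q) x)
    - cls j (bracket (fun y => j y (beta q y)) (nu p) x)
    - cls j (bracket (nu p) (nu q) x).
  rewrite /omega -nabla_flat // !sE (bracketBB x jp snp jq snq).
  rewrite (incl_flat j x (sb p) (sb q)).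
  rewrite (bracket_antisym x snp jq) opprK -addrA.
  have a1 := (anchor_bracket_isotropy snp (inu q)).2 x.
  have a2 := (anchor_bracket_isotropy jp (inu q)).2 x.
  have a3 := (anchor_bracket_isotropy jq (inu p)).2 x.
  rewrite cls_connection_form; try anchor0.
  rewrite !clsD ?clsN; try anchor0.
  by rewrite !opprD opprK addrA.
rewrite -mulrDr !other_classesB // exprS mulN1r mulNr -mulrN; congr (_ * _).
by rewrite -[X in _ + X]addrA subrKA addrA subrr sub0r.
Qed.

End Pair.

Theorem theorem1 (R : realType) (M : manifold R) (F : foliation M)
    (A B L : lie_algebroid M)
    (A_regular : regular_algebroid A) (B_regular : regular_algebroid B)
    (A_over_F : over_foliation A F) (B_over_F : over_foliation B F)
    (j : subalgebroid B A) (lambda : splitting F B)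
    (nabla : connection L A) (nabla_flat : flat_connection nabla)
    (k : nat) (Psi : Qform j k) :
  is_Qform Psi -> B_invariant Psi ->
  dL (Delta_hom lambda nabla Psi) = Delta_hom lambda nabla (bar_delta Psi).
Proof.
move=> Psi_form Psi_inv; apply/functional_extensionality_dep => x.
apply/funext => w.
have [xi [sxi xw ->]] : [set r : R | exists xi : 'I_k.+1 -> forall x, L x,
    [/\ forall i, section_smooth (xi i), forall i, xi i x = w i
      & r = dL_formula (Delta_hom lambda nabla Psi) xi x]]
    (dL (Delta_hom lambda nabla Psi) x w).
  apply: xgetPex.
  have /fin_all_exists2[xi sxi xw] i := section_extension (w i).
  by exists (dL_formula (Delta_hom lambda nabla Psi) xi x), xi.
have [inu ->] := dL_Delta_formula
  Psi_form Psi_inv lambda B_over_F A_over_F nabla_flat x sxi.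
set nu := fun i y => - connection_form j lambda (nabla y (xi i y)).
(* The section [nu] shows that the values defining the right-hand side exist, but
   the value picked there may come from another family [nu'] of representatives. *)
have [nu' [inu' nuw E]] : [set r : R | exists nu' : 'I_k.+1 -> forall x, A x,
    [/\ forall i, isotropy_section (nu' i),
        forall i, cls j (nu' i x) = omega j lambda nabla (w i)
      & r = bar_delta_formula Psi nu' x]]
    (bar_delta Psi x (fun i => omega j lambda nabla (w i))).
  apply: xgetPex.
  exists (bar_delta_formula Psi nu x), nu; split=> // i.
  by rewrite /omega -xw.
rewrite /Delta_hom E; apply/esym.
apply: (bar_delta_formula_cls Psi_form Psi_inv lambda B_over_F inu inu').
by move=> i; rewrite nuw /nu /omega xw.
Qed.
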